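(* Let $(X,d)$ be a separable metric space, let $T\colon X\to X$ be a Borel measurable map, and let $\mu$ be a $T$-invariant, ergodic, Borel probability measure on $X$. Then for every $\alpha>0$ and for $\mu$-almost every $x\in X$, $$\liminf_{n\to\infty} n\,\big(d(T^n(x),x)\big)^\alpha \;\le\; g(x):=\limsup_{r\to 0}\frac{H_\alpha(B(x,r))}{\mu(B(x,r))},$$ where $g(x)$ takes values in $[0,+\infty]$ (the values $0$ and $+\infty$ are allowed).
   Context: $B(x,r)$ denotes the open ball of radius $r$ centred at $x$. For $\alpha>0$, $H_\alpha$ denotes the $\alpha$-dimensional Hausdorff (outer) measure with the normalization $$H_\alpha(Y)=\lim_{r\to 0}\inf\Big\{\sum_{k=1}^\infty(\operatorname{diam}U_k)^\alpha : \operatorname{diam}U_k<r \text{ for all } k,\ Y\subset\bigcup_{k=1}^\infty U_k\Big\},$$ the infimum being over all countable covers of $Y$ satisfying these conditions (no additional multiplicative constant), restricted to the measurable sets given by Carathéodory's construction. No relation between $\mu$ and $H_\alpha$ is assumed. For $x$ outside the support of $\mu$, $g(x)$ is understood to be $+\infty$. *)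

(* Defs.v *)
From HB Require Import structures.
From mathcomp Require Import all_boot all_order all_algebra.
From mathcomp Require Import all_classical all_reals all_analysis.

Set Implicit Arguments.
Unset Strict Implicit.
Unset Printing Implicit Defensive.

Import Order.TTheory GRing.Theory Num.Theory.
Import numFieldNormedType.Exports.

Local Open Scope classical_set_scope.
Local Open Scope ring_scope.
Local Open Scope ereal_scope.

(* Pointedness is only what [measurableType] demands of its carrier; it costs
   nothing on a space that carries a probability measure. *)
#[short(type="pmetricType")]
HB.structure Definition PMetric (R : numDomainType) :=
  { X of Metric R X & isPointed X }.

Definition separable (X : topologicalType) : Prop :=
  exists D : set X, countable D /\ dense D.

Notation borel X := (g_sigma_algebraType (@open X)).

Section hausdorff.
Context {R : realType} {X : metricType R}.
Implicit Types (Y U : set X) (alpha r : R).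

(* The element 0 is adjoined because [ereal_sup set0 = -oo], whereas the
   diameter of the empty set is 0. *)
Definition diam U : \bar R :=
  ereal_sup (0 |` [set (mdist x y)%:E | x in U & y in U]).

Definition hausdorff_content alpha r Y : \bar R :=
  ereal_inf [set \sum_(0 <= k <oo) diam (U k) `^ alpha | U in
    [set U : (set X)^nat |
      (forall k, diam (U k) < r%:E) /\ Y `<=` \bigcup_k U k]].

(* The outer measure, defined on all subsets of [X]: open balls are
   Caratheodory measurable, so the restriction to measurable sets takes the
   same values on them. *)
Definition hausdorff alpha Y : \bar R :=
  lim (hausdorff_content alpha r Y @[r --> 0^'+]).

Lemma is_cvg_hausdorff_content alpha Y :
  cvg (hausdorff_content alpha r Y @[r --> 0^'+]).
Proof.
apply: nonincreasing_at_right_is_cvge; apply: nearW => b r s _ _ rs.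
apply: ereal_inf_le_tmp => _ [U [dU YU] <-]; exists U => //; split => // k.
by rewrite (lt_le_trans (dU k))// lee_fin.
Qed.

End hausdorff.

Section dynamics.
Context {R : realType} {X : pmetricType R}.
Implicit Types (mu : probability (borel X) R) (T : X -> X).

Definition invariant_measure mu T : Prop :=
  forall A : set (borel X), measurable A -> mu (T @^-1` A) = mu A.

Definition ergodic mu T : Prop :=
  forall A : set (borel X), measurable A -> T @^-1` A = A ->
    mu A = 0 \/ mu A = 1.

Definition msupport mu : set X :=
  [set x | forall U : set X, open U -> U x -> 0 < mu U].

Definition upper_density_ratio mu (alpha : R) (x : X) : \bar R :=
  if x \in msupport mu then
    limf_esup (fun r : R => hausdorff alpha (ball x r) / mu (ball x r)) 0^'+
  else +oo.

End dynamics.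

(* Main.v *)
Require Import Defs.
From HB Require Import structures.
From mathcomp Require Import all_boot all_order all_algebra.
From mathcomp Require Import all_classical all_reals all_analysis.
From mathcomp Require Import measurable_realfun ring lra.

Set Implicit Arguments.
Unset Strict Implicit.
Unset Printing Implicit Defensive.

Import Order.TTheory GRing.Theory Num.Theory.
Import numFieldNormedType.Exports.

Local Open Scope classical_set_scope.
Local Open Scope ring_scope.
Local Open Scope ereal_scope.

(** Let [S] be the set of points all of whose close returns satisfy
    [n d(T^n x, x)^alpha >= c'], and let [c < c'].  A subset [E] of [S] of small
    diameter is disjoint from its preimages up to time [c' / (diam E)^alpha], so
    invariance gives [c' mu(E) <= (diam E)^alpha]; hence [c' mu(S /\ Y) <=
    H_alpha(Y)] for every Borel set [Y].  If moreover [H_alpha(B) <= c mu(B)] for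
    all small balls [B] centred at the points of a set [A] in [S], then the
    complement of [S] carries at least the fraction [1 - c/c'] of each of these
    balls, and a density argument shows that [A] is null.

    Lebesgue's density theorem for balls fails in general metric spaces, so the
    density argument goes through [H_alpha], which is finite near [A]: in a
    nearly optimal cover of [A], the pieces on which [mu] is much smaller than
    [diam^alpha] are negligible in total, and the others generate balls on which
    [mu] is comparable to [radius^alpha].  A Vitali selection of disjoint balls
    among the latter bounds [mu(A)] by the measure of a thin neighbourhood of
    [S] minus [S], where [S] has first been replaced by a closed subset. *)

(** * Balls and diameters in a metric space *)

Section metric_diameter.
Context {R : realType} {X : metricType R}.
Implicit Types (x y : X) (U V Y : set X) (a r : R).

(* The library states these over a [realFieldType]; the copies over a [realType]
   keep the inferred structures syntactically equal, as [lra] requires. *)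
Lemma mdistC x y : mdist x y = mdist y x.
Proof. exact: metric_sym. Qed.

Lemma mdist_triangle y x z : (mdist x z <= mdist x y + mdist y z)%R.
Proof. exact: metric_triangle. Qed.

Lemma ball_mdist x r y : ball x r y <-> (mdist x y < r)%R.
Proof. by rewrite ballEmdist. Qed.

Lemma metric_ball_open x r : open (ball x r).
Proof.
rewrite openE => y /ball_mdist xy; apply/nbhs_ballP.
exists (r - mdist x y)%R => /=; first by rewrite subr_gt0.
move=> z /ball_mdist yz; apply/ball_mdist.
by rewrite (le_lt_trans (mdist_triangle y _ _))// -ltrBrDl.
Qed.

Lemma diam_ge0 U : 0 <= diam U.
Proof. by apply: ereal_sup_ubound; left. Qed.

Lemma mdist_le_diam U x y : U x -> U y -> (mdist x y)%:E <= diam U.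
Proof. by move=> Ux Uy; apply: ereal_sup_ubound; right; exists x => //; exists y. Qed.

Lemma diam_le U (M : \bar R) : 0 <= M ->
  (forall x y, U x -> U y -> (mdist x y)%:E <= M) -> diam U <= M.
Proof.
move=> M0 UM; apply: ge_ereal_sup => _ [->//|[x Ux [y Uy <-]]].
exact: UM.
Qed.

(** Covering sets are arbitrary; this lets them be replaced by their closures, which are Borel, at
    no cost in the Hausdorff sums. *)
Lemma diam_closure U : diam (closure U) = diam U.
Proof.
apply/le_anti/andP; split; last first.
  apply: diam_le; first exact: diam_ge0.
  by move=> x y Ux Uy; apply: mdist_le_diam; exact: subset_closure.
apply: diam_le; first exact: diam_ge0.
move=> x y xU yU; apply/lee_addgt0Pr => e e0.
have e2 : (0 < e / 2)%R by rewrite divr_gt0.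
have [x' [Ux' xx']] := xU _ (nbhsx_ballx x (e / 2)%R e2).
have [y' [Uy' yy']] := yU _ (nbhsx_ballx y (e / 2)%R e2).
move/ball_mdist : xx' => xx'; move/ball_mdist : yy' => yy'.
rewrite (@le_trans _ _ ((mdist x' y')%:E + e%:E))//; last first.
  by rewrite leeD2r// mdist_le_diam.
rewrite -EFinD lee_fin.
have := mdist_triangle x' x y; have := mdist_triangle y' x' y.
rewrite (mdistC y' y); lra.
Qed.

Lemma diam_ball x r : (0 <= r)%R -> diam (ball x r) <= (2 * r)%:E.
Proof.
move=> r0; apply: diam_le; first by rewrite lee_fin mulr_ge0.
move=> y z /ball_mdist xy /ball_mdist xz; rewrite lee_fin.
have := mdist_triangle x y z; rewrite (mdistC y x); lra.
Qed.

End metric_diameter.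

(** * Monotonicity and covers for Hausdorff measure *)

Section hausdorff_theory.
Context {R : realType} {X : metricType R}.
Implicit Types (U Y Z : set X) (alpha r : R).

Lemma hausdorff_content_le alpha r Y : (0 < r)%R ->
  hausdorff_content alpha r Y <= hausdorff alpha Y.
Proof.
move=> r0; apply: lime_ge; first exact: is_cvg_hausdorff_content.
near=> s; apply: ereal_inf_le_tmp => _ [U [dU YU] <-]; exists U => //; split => // k.
rewrite (lt_le_trans (dU k))// lee_fin ltW//.
Unshelve. all: by end_near. Qed.

Lemma hausdorff_content_ge0 alpha r Y : 0 <= hausdorff_content alpha r Y.
Proof.
apply: le_ereal_inf_tmp => _ [U _ <-].
by apply: nneseries_ge0 => k _ _; exact: poweR_ge0.
Qed.

Lemma hausdorff_ge0 alpha Y : 0 <= hausdorff alpha Y.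
Proof.
exact: le_trans (hausdorff_content_ge0 _ _ _) (hausdorff_content_le alpha Y ltr01).
Qed.

Lemma le_hausdorff alpha Y Z : Y `<=` Z -> hausdorff alpha Y <= hausdorff alpha Z.
Proof.
move=> YZ; apply: lee_lim; [exact: is_cvg_hausdorff_content..|].
apply: nearW => r; apply: ereal_inf_le_tmp => _ [U [dU ZU] <-]; exists U => //.
by split => //; exact: subset_trans ZU.
Qed.

Lemma hausdorff_cover alpha r Y (L : \bar R) : (0 < r)%R -> hausdorff alpha Y < L ->
  exists U : (set X)^nat, [/\ forall k, diam (U k) < r%:E,
    Y `<=` \bigcup_k U k & \sum_(0 <= k <oo) diam (U k) `^ alpha < L].
Proof.
move=> r0 YL.
have /ereal_inf_lt[_ [U [dU YU] <-] UL] :=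
  le_lt_trans (hausdorff_content_le alpha Y r0) YL.
by exists U.
Qed.

End hausdorff_theory.

(** * Borel sets and measurability of the displacement *)

Section borel_metric.
Context {R : realType} {X : pmetricType R}.
Implicit Types (T : X -> X) (U : set X).

Lemma open_borel U : open U -> measurable (U : set (borel X)).
Proof. by move=> oU; exact: sub_sigma_algebra. Qed.

Lemma closed_borel U : closed U -> measurable (U : set (borel X)).
Proof.
move=> cU; rewrite -[U]setCK; apply: measurableC.
by apply: open_borel; exact: closed_openC.
Qed.

Lemma ball_borel (x : X) (r : R) : measurable (ball x r : set (borel X)).
Proof. by apply: open_borel; exact: metric_ball_open. Qed.

Lemma measurable_iter (f : X -> X) n :
  measurable_fun [set: borel X] (f : borel X -> borel X) ->
  measurable_fun [set: borel X] (iter n f : borel X -> borel X).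
Proof.
move=> mf; elim: n => [|n ih]; first exact: (@measurable_id _ (borel X)).
exact: (measurableT_comp mf ih).
Qed.

(** Separability leaves countably many conditions: [mdist (f x) x < s] means that some [q] in the
    dense set is closer than [1/(n+1)] to [f x] and closer than [s - 1/(n+1)] to [x]. *)
Lemma measurable_mdist_self (f : X -> X) : separable X ->
  measurable_fun [set: borel X] (f : borel X -> borel X) ->
  measurable_fun [set: borel X] (fun x : borel X => mdist (f x) x : R).
Proof.
move=> [D [cD dD]] mf.
apply: (measurability _ (RGenInftyO.measurableE R)) => _ [_ [s ->] <-].
rewrite setTI.
have -> : (fun x : borel X => mdist (f x) x : R) @^-1` `]-oo, s[ =
    \bigcup_n \bigcup_(q in D)
      (f @^-1` ball q n.+1%:R^-1 `&` ball q (s - n.+1%:R^-1)).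
  apply/seteqP; split => [x|x [n _ [q Dq [/= /ball_mdist qfx /ball_mdist qx]]]];
    rewrite /= in_itv/=.
  - rewrite -subr_gt0 => fxs.
    have [n] : exists n, (n.+1%:R^-1 < (s - mdist (f x) x) / 2)%R.
      have fxs2 : (0 < (s - mdist (f x) x) / 2)%R by rewrite divr_gt0.
      by have [n _ /(_ n (leqnn n))] := near_infty_natSinv_lt (PosNum fxs2); exists n.
    have n0 : (0 < n.+1%:R^-1 :> R)%R by rewrite invr_gt0.
    suff near_fx (e : R) : (0 < e)%R -> (e < (s - mdist (f x) x) / 2)%R ->
        exists2 q, D q & (mdist q (f x) < e)%R /\ (mdist q x < s - e)%R.
      move=> /(near_fx _ n0)[q Dq [qfx qx]].
      by exists n => //; exists q => //; split; apply/ball_mdist.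
    move=> e0 efx; have [q [/ball_mdist fxq Dq]] : ball (f x) e `&` D !=set0.
      apply: dD; last exact: metric_ball_open.
      by exists (f x); exact: ballxx.
    exists q => //; rewrite mdistC; split => //.
    rewrite mdistC; have := mdist_triangle (f x) x q.
    by rewrite (mdistC x (f x)); lra.
  - rewrite (le_lt_trans (mdist_triangle q _ _))// (mdistC (f x)).
    by have := ltrD qfx qx; rewrite [ltRHS]addrC subrK.
apply: bigcup_measurable => n _; rewrite bigcup_set_type; apply: countable_bigcupT_measurable => [|q].
  by rewrite (eq_countable (card_setT D)).
apply: measurableI; last exact: ball_borel.
by rewrite -[X in measurable X]setTI; apply: mf => //; exact: ball_borel.
Qed.

End borel_metric.

(** * Recurrence times and invariance *)

Section recurrence.
Context {R : realType} {X : pmetricType R} (T : X -> X).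
Variable mu : probability (borel X) R.
Hypothesis mT : measurable_fun [set: borel X] (T : borel X -> borel X).
Hypothesis invT : invariant_measure mu T.
Implicit Types (alpha c delta : R).

(** Constraining close returns rather than late ones makes the bound apply at every positive time to
    a point and an iterate lying in a common set of diameter below [delta]. *)
Definition slow_return alpha c delta : set X :=
  [set x | forall n, (0 < n)%N -> (mdist (iter n T x) x < delta)%R ->
    (c <= n%:R * mdist (iter n T x) x `^ alpha)%R].

Lemma slow_return_borel alpha c delta : separable X ->
  measurable (slow_return alpha c delta : set (borel X)).
Proof.
move=> sepX.
have -> : slow_return alpha c delta = \bigcap_(n in [set n | (0 < n)%N])
    ([set x | (delta <= mdist (iter n T x) x)%R] `|`
     [set x | (c <= n%:R * mdist (iter n T x) x `^ alpha)%R]).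
  apply/seteqP; split => x /= Ax n n0.
    by have [?|?] := leP delta (mdist (iter n T x) x); [left|right; exact: Ax].
  by case: (Ax n n0) => //= + /lt_geF; move=> ->.
apply: bigcap_measurableType => n _.
have mh := measurable_mdist_self sepX (measurable_iter n mT).
apply: measurableU.
- have := mh measurableT _ (measurable_itv `[delta, +oo[).
  rewrite setTI; congr (measurable _).
  by apply/seteqP; split => x /=; rewrite in_itv/= andbT.
- have mg : measurable_fun [set: borel X]
      (fun x : borel X => n%:R * mdist (iter n T x) x `^ alpha : R)%R.
    apply: measurable_funM => //.
    exact: (measurableT_comp (measurable_powR alpha) mh).
  have := mg measurableT _ (measurable_itv `[c, +oo[).
  rewrite setTI; congr (measurable _).
  by apply/seteqP; split => x /=; rewrite in_itv/= andbT.
Qed.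

Lemma measure_preimage_iter n (E : set (borel X)) : measurable E ->
  measurable (iter n T @^-1` E : set (borel X)) /\ mu (iter n T @^-1` E) = mu E.
Proof.
move=> mE; elim: n => [|n [mn <-]]; first by split.
rewrite (_ : iter n.+1 T @^-1` E = T @^-1` (iter n T @^-1` E)); last first.
  by apply/seteqP; split => x /=; rewrite -iterS iterSr.
by split; [rewrite -[X in measurable X]setTI; exact: mT|exact: invT].
Qed.

(** The preimages of [E] under the iterates of index below [N] have measure [mu E] and are disjoint:
    a point common to those of index [i < j], moved by [T^i], would return to [E] after [j - i]
    steps. *)
Lemma disjoint_preimages_le1 (E : set (borel X)) N : measurable E ->
  (forall n x, (0 < n < N)%N -> E x -> ~ E (iter n T x)) ->
  N%:R%:E * mu E <= 1.
Proof.
move=> mE noret.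
pose F i := iter i T @^-1` E : set (borel X).
have mF i : measurable (F i) by case: (measure_preimage_iter i mE).
have dF i j x : (i < j < N)%N -> F i x -> ~ F j x.
  move=> /andP[ij jN] Fi Fj; apply: (noret (j - i)%N (iter i T x)) => //.
    by rewrite subn_gt0 ij (leq_ltn_trans (leq_subr _ _)).
  by rewrite /F/= -iterD subnK// ltnW.
have tF : trivIset `I_N F.
  move=> i j /= iN jN [x [Fix Fjx]]; case: (ltngtP i j) => // ij.
    by case: (@dF i j x) => //; rewrite ij.
  by case: (@dF j i x) => //; rewrite ij.
rewrite (le_trans _ (@probability_le1 _ _ _ mu (\bigcup_(i in `I_N) F i) _))//.
  rewrite measure_fin_bigcup//= -fsbig_ord.
  rewrite (eq_bigr (fun=> mu E)); last first.
    by move=> i _; case: (measure_preimage_iter i mE).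
  by rewrite sumr_const card_ord mule_natl.
by apply: fin_bigcup_measurable.
Qed.

(* If [c * mu E] exceeded [(diam U)^alpha], then no point of [E] would return to
   [E] within time [1 / mu E], and too many preimages of [E] would be disjoint. *)
Lemma slow_return_diam alpha c delta (A U : set (borel X)) : (0 < alpha)%R ->
  measurable A -> measurable U -> A `<=` slow_return alpha c delta ->
  diam U < delta%:E -> c%:E * mu (A `&` U) <= diam U `^ alpha.
Proof.
move=> alpha0 mA mU slowA.
have : 0 <= diam U by exact: diam_ge0.
have := @mdist_le_diam _ _ U.
case: (diam U) => [D| |]//= dU D0; rewrite lte_fin => Ddelta.
rewrite lee_fin in D0.
have mE : measurable (A `&` U) by exact: measurableI.
have finE := fin_num_measure mu _ mE.
set p := fine (mu (A `&` U)).
have pE : mu (A `&` U) = p%:E by rewrite fineK.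
have p0 : (0 <= p)%R by rewrite fine_ge0.
rewrite pE -EFinM lee_fin leNgt; apply/negP => Dcp.
have {}p0 : (0 < p)%R.
  rewrite lt_neqAle p0 andbT eq_sym; apply/negP => /eqP pz.
  by move: Dcp; rewrite pz mulr0 ltNge powR_ge0.
have pV0 : (0 <= p^-1)%R by rewrite invr_ge0 ltW.
(* Let [N] be the integer part of [1/p]. As [(N + 1) p > 1], some point returns at a time [n <= N];
   then [n d^alpha <= D^alpha / p < c], against slowness. *)
have /andP[Np pN] := truncn_itv pV0.
have := @disjoint_preimages_le1 (A `&` U) (Num.truncn p^-1).+1 mE.
rewrite pE -EFinM lee_fin leNgt -ltr_pdivrMr// div1r pN => H.
apply: notF; apply: H => n x /andP[n0 nN] [Ax Ux] [_ Unx].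
have dnx : (mdist (iter n T x) x <= D)%R by rewrite -lee_fin dU.
have := slowA _ Ax n n0 (le_lt_trans dnx Ddelta).
apply/negP; rewrite -ltNge (@le_lt_trans _ _ (p^-1 * D `^ alpha)%R)//.
  apply: ler_pM => //; first exact: powR_ge0.
    by rewrite (le_trans _ Np)// ler_nat -ltnS.
  by rewrite ge0_ler_powR// ?nnegrE// ?mdist_ge0// ltW.
by rewrite mulrC ltr_pdivrMr.
Qed.

End recurrence.

(** * Vitali selection *)

(** Greedy choice: keep a set of largest size [r], discard every set that meets it, and repeat. The
    enlargement of balls is left to the application. *)
Lemma finite_vitali {R : realType} {T : Type} (B : nat -> set T) (r : nat -> R)
    (s : seq nat) : (forall i, i \in s -> B i !=set0) ->
  exists D : set nat, [/\ D `<=` [set` s], trivIset D B &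
    forall i, i \in s -> exists2 j, D j & (r i <= r j)%R /\ B i `&` B j !=set0].
Proof.
pose ger i j := (r j <= r i)%R.
have ger_trans : transitive ger by move=> j i k /[swap]; exact: le_trans.
wlog srt : s / sorted ger s.
  have srt : sorted ger (sort ger s) by apply: sort_sorted => i j; exact: le_total.
  move=> /(_ _ srt) wl Bs.
  have [i|D [Ds tD sD]] := wl; first by rewrite mem_sort; exact: Bs.
  exists D; split => //; first by move=> i /Ds; rewrite /= mem_sort.
  by move=> i si; apply: sD; rewrite mem_sort.
have [n] := ubnP (size s); elim: n s srt => // n ih [_ _ _|x s]/=.
  by exists set0; split => // i j [].
rewrite ltnS => pxs sn Bs.
pose s' := [seq y <- s | `[< B x `&` B y = set0 >]].
have [|||D [Ds tD sD]] := ih s'.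
- exact/(sorted_filter ger_trans)/(path_sorted pxs).
- by rewrite (leq_ltn_trans _ sn)// size_filter count_size.
- by move=> i; rewrite mem_filter => /andP[_ si]; apply: Bs; rewrite inE si orbT.
have xD j : D j -> B x `&` B j = set0.
  by move=> /Ds/=; rewrite mem_filter => /andP[/asboolP].
exists (x |` D); split.
- move=> i [->|/Ds]/=; first by rewrite mem_head.
  by rewrite mem_filter inE => /andP[_ ->]; rewrite orbT.
- move=> i j [->|Di] [->|Dj]//; last exact: tD.
  + by rewrite xD// => -[].
  + by rewrite setIC xD// => -[].
- move=> i; rewrite inE => /predU1P[->|si].
    exists x; first by left.
    by split => //; rewrite setIid; apply: Bs; rewrite mem_head.
  have [Bxi|/eqP/set0P Bxi] := pselect (B x `&` B i = set0).
    have [|j Dj ij] := sD i; first by rewrite mem_filter si andbT; exact/asboolP.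
    by exists j => //; right.
  exists x; first by left.
  split; last by rewrite setIC.
  exact: (allP (order_path_min ger_trans pxs)).
Qed.

(** * Regularity of Borel probability measures *)

Section regularity.
Context {R : realType} {X : pmetricType R} (mu : probability (borel X) R).
Implicit Types (F V : set X) (A : set (borel X)) (e : R).

(** Continuity from above: the thickenings by [1/(n+1)] decrease to [F] because [F] is closed. *)
Lemma closed_thickening F e : closed F -> (0 < e)%R ->
  exists2 d : R, (0 < d)%R & mu (\bigcup_(x in F) ball x d `\` F) < e%:E.
Proof.
move=> cF e0.
pose V n := \bigcup_(x in F) ball x n.+1%:R^-1.
have oV n : open (V n) by apply: bigcup_open => x _; exact: metric_ball_open.
have FV n : F `<=` V n by move=> x Fx; exists x => //; exact: ballxx.
have mVF n : measurable (V n `\` F : set (borel X)).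
  by apply: measurableD; [exact: open_borel|exact: closed_borel].
have VF0 : \bigcap_n (V n `\` F) = set0.
  rewrite -subset0 => x VFx; have [_ Fx] := VFx 0%N I; apply: Fx.
  apply: cF => U /nbhs_ballP[d /= d0 xdU].
  have [n _ /(_ n (leqnn n)) nd] := near_infty_natSinv_lt (PosNum d0).
  have [[y Fy /ball_sym yx] _] := VFx n I.
  by exists y; split => //; apply: xdU; apply: le_ball yx; exact: ltW.
have : mu (V n `\` F) @[n --> \oo] --> 0.
  rewrite -(measure0 mu) -VF0; apply: nonincreasing_cvg_mu => //.
  - by rewrite (le_lt_trans (probability_le1 _ (mVF _)))// ltry.
  - by rewrite VF0; exact: measurable0.
  - move=> m n mn; apply/subsetPset => x [[y Fy yx] nFx]; split => //.
    exists y => //; apply: le_ball yx.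
    by rewrite lef_pV2 ?posrE// ler_nat.
move=> /fine_cvgP[_].
move=> /cvgr_lt/(_ e e0)[n _ /(_ n (leqnn n))/=] Ve.
by exists n.+1%:R^-1%R; rewrite ?invr_gt0// -(fineK (fin_num_measure mu _ (mVF n))) lte_fin.
Qed.

(** The sets with this property form a sigma-algebra containing the open sets; an open set is
    approximated from inside by the complement of a thin thickening of its complement. *)
Lemma borel_regular A e : measurable A -> (0 < e)%R ->
  exists F V, [/\ closed F, open V, F `<=` A, A `<=` V & mu (V `\` F) < e%:E].
Proof.
pose P := [set A : set X | forall e, (0 < e)%R ->
  exists F V, [/\ closed F, open V, F `<=` A, A `<=` V & mu (V `\` F) < e%:E]].
suff : <<s @open X >> `<=` P by move=> /[apply]/(_ e)/[apply].
move: e => _; apply: smallest_sub; last first.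
  move=> U oU e e0.
  have [d d0] := closed_thickening (open_closedC oU) e0.
  set V := \bigcup_(x in _) _ => VU.
  have oV : open V by apply: bigcup_open => x _; exact: metric_ball_open.
  have UV : ~` U `<=` V by move=> x Ux; exists x => //; exact: ballxx.
  exists (~` V), U; split => //; first exact: open_closedC.
    by rewrite -[U]setCK; exact: subsetC.
  by rewrite !setDE !setCK setIC in VU *.
split.
- move=> e e0; exists set0, set0; split; [exact: closed0|exact: open0|by []|by []|].
  by rewrite setD0 measure0.
- move=> B PB e e0; have [F [V [cF oV FB BV VF]]] := PB e e0.
  exists (~` V), (~` F); rewrite !setTD; split.
  + exact: open_closedC.
  + exact: closed_openC.
  + exact: subsetC.
  + exact: subsetC.
  + by rewrite setDE setCK setIC -setDE.
- move=> B PB e e0.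
  have e2 : (0 < e / 2)%R by rewrite divr_gt0.
  (* These errors add up to [e / 2]. The rest of [e] pays for truncating the union of the closed
     sets, since only a finite one is sure to be closed. *)
  have /choice[FV HFV] n : exists FV : set X * set X,
      [/\ closed FV.1, open FV.2, FV.1 `<=` B n, B n `<=` FV.2 &
        mu (FV.2 `\` FV.1) < (e / 2 / (2 ^ n.+1)%:R)%:E].
    have en : (0 < e / 2 / (2 ^ n.+1)%:R)%R by rewrite divr_gt0// ltr0n expn_gt0.
    by have [F [V H]] := PB n _ en; exists (F, V).
  pose F n := (FV n).1; pose V := \bigcup_n (FV n).2.
  have mF n : measurable (F n : set (borel X)).
    by apply: closed_borel; case: (HFV n).
  have oV : open V by apply: bigcup_open => n _; case: (HFV n).
  have mV : measurable (V : set (borel X)) by exact: open_borel.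
  pose G N := V `\` \big[setU/set0]_(i < N) F i.
  have mG N : measurable (G N : set (borel X)).
    by apply: measurableD => //; apply: bigsetU_measurable.
  have GE : \bigcap_N G N = V `\` \bigcup_n F n.
    apply/seteqP; split => [x Gx|x [Vx nF] N _].
      split; first by case: (Gx 0%N I).
      move=> [n _ Fnx]; case: (Gx n.+1 I) => _; apply.
      by rewrite big_ord_recr/=; right.
    by split => //; rewrite -bigcup_mkord => -[n _ Fnx]; apply: nF; exists n.
  have mGI : measurable (\bigcap_N G N : set (borel X)).
    by apply: bigcap_measurableType.
  have muG : mu (\bigcap_N G N) <= (e / 2)%:E.
    rewrite (@le_trans _ _ (\sum_(0 <= n <oo) mu ((FV n).2 `\` (FV n).1)))//.
      apply: measure_sigma_subadditive => //.
        move=> n; apply: measurableD; last exact: mF.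
        by apply: open_borel; case: (HFV n).
      rewrite GE => x [[n _ Vx] nF]; exists n => //; split => // Fx.
      by apply: nF; exists n.
    rewrite (le_trans _ (epsilon_trick0 xpredT (ltW e2)))//.
    apply: lee_nneseries => // n _; rewrite ltW//.
    by case: (HFV n).
  have : mu (G N) @[N --> \oo] --> mu (\bigcap_N G N).
    apply: nonincreasing_cvg_mu => //.
    - by rewrite (le_lt_trans (probability_le1 _ (mG _)))// ltry.
    - move=> m n mn; apply/subsetPset; apply: setDS.
      exact: subset_bigsetU.
  have finGI := fin_num_measure mu _ mGI.
  rewrite -(fineK finGI) => /fine_cvgP[_].
  have ltGI : (fine (mu (\bigcap_N G N)) < e)%R.
    rewrite -lte_fin fineK// (le_lt_trans muG)// lte_fin ltr_pdivrMr//.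
    by rewrite ltr_pMr// ltr1n.
  move=> /cvgr_lt/(_ e ltGI)[N _ /(_ N (leqnn N))/=] Ge.
  exists (\big[setU/set0]_(i < N) F i), V; split => //.
  + rewrite -bigcup_mkord; by apply: closed_bigcup => // n _; case: (HFV n).
  + rewrite -bigcup_mkord => x [n _ Fx]; exists n => //.
    by case: (HFV n) => _ _ + _ _; exact.
  + by move=> x [n _ Bx]; exists n => //; case: (HFV n) => _ _ _ + _; exact.
  + by rewrite -(fineK (fin_num_measure mu _ (mG N))) lte_fin.
Qed.

End regularity.

(** * Outer estimates for measures *)

Section measure_estimates.
Context d {R : realType} {T : measurableType d} (mu : {measure set T -> \bar R}).

Lemma measure_bigcup_le_series (D : set nat) (F : nat -> set T) (g : nat -> \bar R) :
  (forall k, D k -> measurable (F k)) -> (forall k, D k -> mu (F k) <= g k) ->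
  mu (\bigcup_(k in D) F k) <= \sum_(k <oo | k \in D) g k.
Proof.
move=> mF Fg; rewrite bigcup_mkcond eseries_mkcond.
have mF' k : measurable (if k \in D then F k else set0).
  by case: ifPn => // /set_mem; exact: mF.
rewrite (@le_trans _ _ (\sum_(0 <= k <oo) mu (if k \in D then F k else set0)))//.
  by apply: measure_sigma_subadditive => //; exact: bigcupT_measurable.
apply: lee_nneseries => // k _; case: ifPn => [/set_mem|_]; first exact: Fg.
by rewrite measure0.
Qed.

(** Intersect the sets [M] found for [e = 1/(n+1)]. This serves sets such as [hausdorff_dominated],
    whose measurability is never established. *)
Lemma negligible_outer (A : set T) :
  (forall e : R, (0 < e)%R ->
    exists M, [/\ measurable M, A `<=` M & mu M <= e%:E]) ->
  mu.-negligible A.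
Proof.
move=> H; have /choice[M HM] n : exists M, [/\ measurable M, A `<=` M &
    mu M <= n.+1%:R^-1%:E] by apply: H; rewrite invr_gt0.
have mM : measurable (\bigcap_n M n).
  by apply: bigcap_measurableType => n _; case: (HM n).
exists (\bigcap_n M n); split => //; last first.
  by move=> x Ax n _; case: (HM n) => _ + _; exact.
apply/eqP; rewrite -measure_le0; apply/lee_addgt0Pr => e e0; rewrite add0e.
have [n _ /(_ n (leqnn n)) ne] := near_infty_natSinv_lt (PosNum e0).
case: (HM n) => mMn _ Mn; rewrite (@le_trans _ _ (mu (M n)))//.
  by apply: le_measure; rewrite ?inE//; exact: bigcap_inf.
by rewrite (le_trans Mn)// lee_fin ltW.
Qed.

End measure_estimates.

(** * Density estimates for a set [F] with the diameter bound of [slow_return_diam] *)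

Section density.
Context {R : realType} {X : pmetricType R} (mu : probability (borel X) R).
Variables (F : set X) (alpha delta c c' : R).
Hypothesis mF : measurable (F : set (borel X)).
Hypothesis alpha0 : (0 < alpha)%R.
Hypothesis delta0 : (0 < delta)%R.
Hypotheses (c0 : (0 < c)%R) (cc' : (c < c')%R).
Hypothesis diamF : forall U : set (borel X), measurable U -> diam U < delta%:E ->
  c'%:E * mu (F `&` U) <= diam U `^ alpha.

Let c'0 : (0 < c')%R. Proof. exact: lt_trans cc'. Qed.

Lemma measure_le_hausdorff (Y : set X) : measurable (Y : set (borel X)) ->
  c'%:E * mu (F `&` Y) <= hausdorff alpha Y.
Proof.
move=> mY; apply: le_trans (hausdorff_content_le alpha Y delta0).
apply: le_ereal_inf_tmp => _ [U [dU YU] <-].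
have mcU k : measurable (closure (U k) : set (borel X)).
  by apply: closed_borel; exact: closed_closure.
rewrite (@le_trans _ _ (c'%:E * \sum_(0 <= k <oo) mu (F `&` closure (U k))))//.
  rewrite lee_pmul2l// ?lte_fin//; apply: measure_sigma_subadditive.
  - by move=> k; exact: measurableI.
  - exact: measurableI.
  - move=> x [Fx /YU[k _ Ux]]; exists k => //; split => //.
    exact: subset_closure.
rewrite -nneseriesZl//; apply: lee_nneseries => [k _ _|k _].
  by apply: mule_ge0 => //; rewrite lee_fin ltW.
by have := diamF (mcU k); rewrite diam_closure; apply.
Qed.

(** By [measure_le_hausdorff], [F] takes at most the fraction [c / c'] of the ball. *)
Lemma measure_ball_le_setD (x : X) (r : R) :
  hausdorff alpha (ball x r) <= c%:E * mu (ball x r) ->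
  (c' - c)%:E * mu (ball x r) <= c'%:E * mu (ball x r `\` F).
Proof.
move=> hb; have mb := ball_borel x r.
have mbF : measurable (ball x r `\` F : set (borel X)) by exact: measurableD.
have mFb : measurable (F `&` ball x r : set (borel X)) by exact: measurableI.
have := le_trans (measure_le_hausdorff mb) hb.
have -> : mu (ball x r) = mu (F `&` ball x r) + mu (ball x r `\` F).
  by rewrite addeC setIC -measureDI.
rewrite -(fineK (fin_num_measure mu _ mbF)) -(fineK (fin_num_measure mu _ mFb)).
by rewrite -EFinD -!EFinM !lee_fin; lra.
Qed.

(** For each [e], [A] is covered by three Borel sets of measure at most [e / 3]: the light pieces of
    a cover ([M1]), its tail ([M2]), and enlargements of disjoint balls selected among the other
    pieces ([M3]). *)
Lemma negligible_density (A : set X) : A `<=` F -> closed F ->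
  hausdorff alpha A < +oo ->
  (forall x r, A x -> (0 < r < delta)%R ->
    hausdorff alpha (ball x r) <= c%:E * mu (ball x r)) ->
  mu.-negligible (A : set (borel X)).
Proof.
move=> AF cF finA hA; apply: negligible_outer => e e0.
pose L := (fine (hausdorff alpha A) + 1)%R.
have AL : hausdorff alpha A < L%:E.
  have : hausdorff alpha A \is a fin_num by rewrite ge0_fin_numE// hausdorff_ge0.
  by move=> /fineK <-; rewrite lte_fin ltrDl.
have L0 : (0 < L)%R by rewrite -lte_fin (le_lt_trans _ AL)// hausdorff_ge0.
have e3 : (0 < e / 3)%R by rewrite divr_gt0.
(* [t] separates light pieces from heavy ones: the light ones total at most [t L = e / 3]. *)
pose t := (e / 3 / L)%R; have t0 : (0 < t)%R by rewrite divr_gt0.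
(* For a heavy piece of diameter [rho] and a ball [B] of radius [2 rho], [C] bounds the measure of
   [F] in the ball of radius [6 rho] by [mu (B \ F)]: it is at most [(12 rho)^alpha / c'], where
   [rho^alpha <= mu B / t] and [mu B <= c' / (c' - c) mu (B \ F)]. *)
pose C := (12 `^ alpha / t * (c' / (c' - c)) / c')%R.
have C0 : (0 < C)%R.
  by rewrite !(mulr_gt0, invr_gt0, powR_gt0)// subr_gt0.
have [d d0 dF] := closed_thickening mu cF (divr_gt0 e3 C0).
set V := \bigcup_(x in F) ball x d in dF.
(* [rho < delta / 12] keeps balls of radius [6 rho] below diameter [delta]; [rho < d / 2] keeps
   balls of radius [2 rho] centred in [F] inside [V]. *)
have rad0 : (0 < Num.min (delta / 12) (d / 2))%R.
  by rewrite lt_min !divr_gt0.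
have [U [dU AU UL]] := hausdorff_cover rad0 AL.
pose rho k := fine (diam (U k)).
have rhoE k : diam (U k) = (rho k)%:E.
  rewrite fineK// ge0_fin_numE ?diam_ge0//.
  by rewrite (lt_trans (dU k)) ?ltry.
have rho_ge0 k : (0 <= rho k)%R by rewrite -lee_fin -rhoE diam_ge0.
have rho_lt k : (rho k < delta / 12)%R /\ (rho k < d / 2)%R.
  by apply/andP; rewrite -lt_min -lte_fin -rhoE.
pose W k := closure (U k).
have mW k : measurable (W k : set (borel X)).
  by apply: closed_borel; exact: closed_closure.
have mFW k : measurable (F `&` W k : set (borel X)) by exact: measurableI.
have FW k : c'%:E * mu (F `&` W k) <= (rho k `^ alpha)%:E.
  have := diamF (mW k); rewrite diam_closure rhoE poweR_EFin lte_fin; apply.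
  by case: (rho_lt k) => + _; move: (rho_ge0 k); lra.
have sumL : \sum_(0 <= k <oo) (rho k `^ alpha)%:E < L%:E.
  move: UL; congr (_ < _); apply: eq_eseriesr => k _.
  by rewrite rhoE poweR_EFin.
have s0 k : 0 <= (rho k `^ alpha)%:E by rewrite lee_fin powR_ge0.
pose G k := (t * rho k `^ alpha)%:E < mu (F `&` W k) /\ A `&` U k !=set0.
have rho_gt0 k : G k -> (0 < rho k)%R.
  move=> [tk _]; rewrite lt_neqAle rho_ge0 andbT eq_sym; apply/eqP => rk0.
  move: (FW k) tk; rewrite rk0 powR0 ?gt_eqF// mulr0.
  by rewrite pmule_rle0 ?lte_fin// => /le_lt_trans/[apply]; rewrite ltxx.
have /choice[x Ux] k : exists x, G k -> A x /\ U k x.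
  have [[_ [x AUx]]|nG] := pselect (G k); first by exists x.
  by exists point => /nG.
(* The factor 2 lets an open ball contain a closed piece of diameter [rho > 0]. *)
pose B k := ball (x k) (2 * rho k).
have WB k : G k -> W k `<=` B k.
  move=> Gk y Wy; apply/ball_mdist.
  have Wx : W k (x k) by apply: subset_closure; case: (Ux k Gk).
  have := mdist_le_diam Wx Wy; rewrite diam_closure rhoE lee_fin.
  by move: (rho_gt0 k Gk); lra.
have tail : \sum_(K <= k <oo) (rho k `^ alpha)%:E @[K --> \oo] --> 0.
  by apply: nneseries_tail_cvg => //; exact: lt_trans sumL (ltry _).
(* The selection needs a finite family; by [FW], the pieces from [K] on have total measure in [F] at
   most [e / 3]. *)
have [K Ktail] : exists K, \sum_(K <= k <oo) (rho k `^ alpha)%:E < (c' * (e / 3))%:E.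
  have ce0 : (0 < c' * (e / 3))%R by rewrite mulr_gt0.
  move/fine_cvgP : tail => [fin_tail /cvgr_lt/(_ _ ce0) lt_tail].
  have [K _ /(_ K (leqnn K))[/= fK ltK]] := filterI fin_tail lt_tail.
  by exists K; rewrite -(fineK fK) lte_fin.
pose s := [seq k <- iota 0 K | `[< G k >]].
have sG k : k \in s <-> (k < K)%N /\ G k.
  by rewrite mem_filter mem_iota add0n; split => [/andP[/asboolP]|[? ?]]//;
    apply/andP; split => //; exact/asboolP.
have [|D [Ds tD sD]] := @finite_vitali _ _ B rho s.
  move=> k /sG[_ Gk]; exists (x k); apply: ballxx.
  by rewrite mulr_gt0// rho_gt0.
pose M1 := \bigcup_(k in [set k | mu (F `&` W k) <= (t * rho k `^ alpha)%:E])
  (F `&` W k).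
pose M2 := \bigcup_(k in ~` `I_K) (F `&` W k).
(* If [B k] meets a selected [B j] with [rho k <= rho j], each point of [B k] is within [2 + 2 + 2]
   times [rho j] of [x j]. *)
pose M3 := \bigcup_(k in D) (F `&` ball (x k) (6 * rho k)).
have mM1 : measurable (M1 : set (borel X)) by exact: bigcup_measurable.
have mM2 : measurable (M2 : set (borel X)) by exact: bigcup_measurable.
have mb6 k : measurable (F `&` ball (x k) (6 * rho k) : set (borel X)).
  by apply: measurableI => //; exact: ball_borel.
have mM3 : measurable (M3 : set (borel X)) by exact: bigcup_measurable.
have muM1 : mu M1 <= (e / 3)%:E.
  rewrite (le_trans (@measure_bigcup_le_series _ _ _ mu _ _
    (fun k => (t * rho k `^ alpha)%:E) _ _))//.
  rewrite (@le_trans _ _ (\sum_(0 <= k <oo) t%:E * (rho k `^ alpha)%:E))//.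
    apply: subset_lee_nneseries => // k _.
    by rewrite lee_fin mulr_ge0 ?powR_ge0// ltW.
  rewrite nneseriesZl// (@le_trans _ _ (t%:E * L%:E))//.
    by rewrite lee_pmul2l ?lte_fin// ltW.
  by rewrite -EFinM divfK// gt_eqF.
have muM2 : mu M2 <= (e / 3)%:E.
  rewrite -(@lee_pmul2l _ c'%:E) ?lte_fin//.
  rewrite (@le_trans _ _ (c'%:E * \sum_(K <= k <oo) mu (F `&` W k)))//.
    rewrite lee_pmul2l// ?lte_fin//.
    exact: measure_sigma_subadditive_tail.
  rewrite -nneseriesZl// (le_trans _ (ltW Ktail))//.
  apply: lee_nneseries => // k _ _.
  by apply: mule_ge0 => //; rewrite lee_fin ltW.
have DG k : D k -> G k by move=> /Ds/sG[].
have muM3k k : D k -> mu (F `&` ball (x k) (6 * rho k)) <= C%:E * mu (B k `\` F).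
  move=> Dk; have Gk := DG k Dk; have [tk _] := Gk.
  have rk0 := rho_gt0 k Gk; have [rkdelta _] := rho_lt k.
  have mBk : measurable (B k : set (borel X)) by exact: ball_borel.
  have mBkF : measurable (B k `\` F : set (borel X)) by exact: measurableD.
  have F6 : c'%:E * mu (F `&` ball (x k) (6 * rho k)) <=
      (12 `^ alpha * rho k `^ alpha)%:E.
    have diam6 : diam (ball (x k) (6 * rho k)) <= (12 * rho k)%:E.
      rewrite (_ : 12 * rho k = 2 * (6 * rho k))%R; last by lra.
      by apply: diam_ball; rewrite mulr_ge0.
    rewrite -powRM// (le_trans (diamF (ball_borel _ _) _))//.
      by rewrite (le_lt_trans diam6)// lte_fin; lra.
    rewrite -poweR_EFin; apply: gt0_ler_poweR => //; first exact: ltW.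
    - by rewrite in_itv/= leey andbT diam_ge0.
    - by rewrite in_itv/= leey andbT lee_fin mulr_ge0.
  have tB : (t * rho k `^ alpha)%:E <= mu (B k).
    rewrite (le_trans (ltW tk))//; apply: le_measure; rewrite ?inE//.
    by move=> y [_]; exact: WB.
  have BF : (c' - c)%:E * mu (B k) <= c'%:E * mu (B k `\` F).
    apply: measure_ball_le_setD; apply: hA; first by case: (Ux k Gk).
    by apply/andP; split; lra.
  move: F6 tB BF.
  rewrite -(fineK (fin_num_measure mu _ (mb6 k))) -(fineK (fin_num_measure mu _ mBk)).
  rewrite -(fineK (fin_num_measure mu _ mBkF)) -!EFinM !lee_fin.
  set f := fine _; set b := fine _; set g := fine _; set q := (12 `^ alpha)%R.
  have q0 : (0 <= q)%R by exact: powR_ge0.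
  move: (rho k `^ alpha)%R => p F6 tB BF.
  have cc0 : (0 < c' - c)%R by rewrite subr_gt0.
  rewrite -(ler_pM2l c'0) (le_trans F6)//.
  rewrite (_ : c' * (C * g) = q / t * (c' * g / (c' - c)))%R; last first.
    by rewrite /C -/q; field; rewrite !gt_eqF.
  rewrite (@le_trans _ _ (q / t * b)%R)//.
    rewrite -mulrA; apply: ler_wpM2l => //.
    by rewrite mulrC ler_pdivlMr// mulrC.
  apply: ler_wpM2l; first by rewrite divr_ge0// ltW.
  by rewrite ler_pdivlMr// mulrC.
have muM3 : mu M3 <= (e / 3)%:E.
  have mBF k : measurable (B k `\` F : set (borel X)).
    by apply: measurableD => //; exact: ball_borel.
  rewrite (le_trans (measure_bigcup_le_series _ muM3k))//.
  (* The sets [B k \ F] with [k] in [D] are disjoint and lie in [V \ F], of measure below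
     [e / 3 / C]. *)
  rewrite nneseriesZl// -measure_bigcup//; last first.
    by move=> i j Di Dj [y [[Bi _] [Bj _]]]; apply: tD => //; exists y.
  rewrite (@le_trans _ _ (C%:E * mu (V `\` F)))//.
    rewrite lee_pmul2l ?lte_fin//; apply: le_measure; rewrite ?inE.
    - exact: bigcup_measurable.
    - apply: measurableD => //; apply: open_borel.
      by apply: bigcup_open => y _; exact: metric_ball_open.
    - move=> y [k Dk [By Fy]]; split => //; exists (x k).
        by apply: AF; case: (Ux k (DG k Dk)).
      by apply: le_ball By; case: (rho_lt k); lra.
  rewrite (@le_trans _ _ (C%:E * (e / 3 / C)%:E))//.
    by rewrite lee_pmul2l ?lte_fin// ltW.
  by rewrite -EFinM mulrC divfK// gt_eqF.
exists (M1 `|` M2 `|` M3); split.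
- by apply: measurableU => //; exact: measurableU.
- move=> y Ay; have Fy := AF _ Ay; have [k _ Uy] := AU _ Ay.
  have Wy : W k y by exact: subset_closure.
  have [Gk|nGk] := pselect (G k); last first.
    left; left; exists k => //=; rewrite leNgt; apply/negP => tk.
    by apply: nGk; split => //; exists y.
  have [kK|Kk] := ltnP k K; last by left; right; exists k => //=; apply/negP; rewrite -leqNgt.
  right; have [|j Dj [kj [z [Bkz Bjz]]]] := sD k; first by apply/sG.
  exists j => //; split => //; apply/ball_mdist.
  move/ball_mdist : Bkz => Bkz; move/ball_mdist : Bjz => Bjz.
  have /ball_mdist By := WB _ Gk _ Wy.
  have := mdist_triangle z (x j) y; have := mdist_triangle (x k) z y.
  by rewrite (mdistC z (x k)); lra.
- rewrite (le_trans (measureU2 _ _ _))//; first exact: measurableU.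
  rewrite (_ : e = e / 3 + e / 3 + e / 3)%R; last by lra.
  rewrite EFinD leeD// (le_trans (measureU2 _ _ _))//.
  by rewrite EFinD leeD.
Qed.

End density.

(** * Countable unions of null sets, and eventual bounds from limits *)

Lemma negligible_countable_bigcup d {R : realType} {T : measurableType d}
    (mu : {measure set T -> \bar R}) {I : Type} (D : set I) (F : I -> set T) :
  countable D -> (forall i, D i -> mu.-negligible (F i)) ->
  mu.-negligible (\bigcup_(i in D) F i).
Proof.
move=> /countable_injP[f /= injf] negF.
apply: (@negligibleS _ _ _ mu
  (\bigcup_n \bigcup_(i in [set i | D i /\ f i = n]) F i)).
  by move=> x [i Di Fx]; exists (f i) => //; exists i.
apply: negligible_bigcup => n.
have [[i [Di fin]]|nD] := pselect (exists i, D i /\ f i = n).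
  apply: negligibleS (negF i Di) => x [j [Dj fjn] Fx].
  by have <- : j = i by apply: injf; rewrite ?inE// fjn.
apply: negligibleS (negligible_set0 mu) => x [i [Di fin] _].
by apply: nD; exists i.
Qed.

Lemma limf_esup_lt {R : realType} {T : choiceType} {X : filteredType T}
    (f : X -> \bar R) (F : set_system X) (a : \bar R) : Filter F ->
  limf_esup f F < a -> \forall x \near F, f x < a.
Proof.
move=> FF /ereal_inf_lt[_ [V FV <-] Va]; apply: filterS FV => x Vx.
by apply: le_lt_trans Va; apply: ereal_sup_ubound; exists x.
Qed.

Lemma lt_limn_einf {R : realType} (u : (\bar R)^nat) (a : \bar R) :
  a < limn_einf u -> \forall n \near \oo, a < u n.
Proof.
rewrite /limn_einf lteNr => /limf_esup_lt ua.
by near do rewrite -lteN2; exact: ua.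
Unshelve. all: by end_near. Qed.

Lemma positive_lower_bound {R : realType} (u : nat -> R) N :
  (forall n, (0 < n)%N -> (0 < u n)%R) ->
  exists2 e : R, (0 < e)%R & forall n, (0 < n < N)%N -> (e <= u n)%R.
Proof.
move=> u0; elim: N => [|N [e e0 eu]].
  by exists 1%R => // n; rewrite ltn0 andbF.
(* With bound 1 the range is empty, whereas [u 0], which need not be positive, would enter the
   minimum. *)
case: N => [|N] in eu *.
  by exists 1%R => // n /andP[n0]; rewrite ltnS leqNgt n0.
exists (Num.min e (u N.+1)); first by rewrite lt_min e0 u0.
move=> n /andP[n0]; rewrite ltnS leq_eqVlt => /predU1P[->|nN].
  by rewrite ge_min lexx orbT.
by rewrite ge_min eu// n0.
Qed.

(** * Slow recurrence against Hausdorff density *)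

Section local_recurrence.
Context {R : realType} {X : pmetricType R} (T : X -> X).
Variable mu : probability (borel X) R.
Implicit Types (alpha c delta : R) (x : X).

Definition hausdorff_dominated alpha c delta : set X :=
  [set x | forall r, (0 < r < delta)%R ->
    hausdorff alpha (ball x r) <= c%:E * mu (ball x r)].

Lemma slow_returnS alpha c delta delta' : (delta' <= delta)%R ->
  slow_return T alpha c delta `<=` slow_return T alpha c delta'.
Proof.
by move=> dd x sx n n0 xn; apply: sx => //; exact: lt_le_trans dd.
Qed.

Lemma hausdorff_dominatedS alpha c delta delta' : (delta' <= delta)%R ->
  hausdorff_dominated alpha c delta `<=` hausdorff_dominated alpha c delta'.
Proof.
move=> dd x sx r /andP[r0 rd]; apply: sx; rewrite r0.
exact: lt_le_trans dd.
Qed.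

(* A periodic point has recurrence [liminf] zero, so the finitely many first
   returns of [x] stay at positive distance. *)
Lemma liminf_slow_return alpha c x : (0 < alpha)%R -> (0 < c)%R ->
  c%:E < limn_einf (fun n => (n%:R * (mdist (iter n T x) x) `^ alpha)%:E) ->
  exists2 delta, (0 < delta)%R & slow_return T alpha c delta x.
Proof.
move=> alpha0 c0 /lt_limn_einf[N _ cN].
have dpos n : (0 < n)%N -> (0 < mdist (iter n T x) x)%R.
  move=> n0; rewrite lt_neqAle mdist_ge0 andbT eq_sym; apply/eqP => dn.
  have {dn} Tn : iter n T x = x by exact: mdist_positivity.
  (* The late time [N * n] would then give the value zero, below [c]. *)
  have Tkn k : iter (k * n) T x = x.
    by elim: k => // k ih; rewrite mulSn iterD ih.
  have := cN (N * n)%N; rewrite /= leq_pmulr// Tkn mdistxx powR0 ?gt_eqF//.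
  by rewrite mulr0 lte_fin => /(_ isT); rewrite ltNge ltW.
have [delta d0 dN] := positive_lower_bound N dpos.
exists delta => // n n0 nd.
have [Nn|nN] := leqP N n; first by have := cN n Nn; rewrite lte_fin => /ltW.
by move: nd; rewrite ltNge dN// n0.
Qed.

(** Off the support the ratio is [+oo], so a finite bound puts [x] in the support; balls around [x]
    then have positive measure and the quotient can be multiplied out. *)
Lemma upper_density_dominated alpha c x : upper_density_ratio mu alpha x < c%:E ->
  exists2 delta, (0 < delta)%R & hausdorff_dominated alpha c delta x.
Proof.
rewrite /upper_density_ratio; case: ifPn => // /set_mem suppx.
move=> /limf_esup_lt /nbhs_ballP[e /= e0 ce].
exists e => // r /andP[r0 re].
have mub0 : 0 < mu (ball x r).
  by apply: suppx; [exact: metric_ball_open|exact: ballxx].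
have mubE := fineK (fin_num_measure mu _ (ball_borel x r)).
have : hausdorff alpha (ball x r) / mu (ball x r) < c%:E.
  by apply: ce => //=; rewrite /ball/= sub0r normrN gtr0_norm.
rewrite -mubE in mub0 *; rewrite lte_fin in mub0.
by rewrite inver gt_eqF// lte_pdivrMr// => /ltW.
Qed.

Lemma upper_density_ratio_ge0 alpha x : 0 <= upper_density_ratio mu alpha x.
Proof.
rewrite /upper_density_ratio; case: ifPn => // _; apply: limf_esup_ge0.
  exact: filter_not_empty.
by move=> r; rewrite mule_ge0 ?inve_ge0 ?hausdorff_ge0.
Qed.

Hypothesis sepX : separable X.
Hypothesis mT : measurable_fun [set: borel X] (T : borel X -> borel X).
Hypothesis invT : invariant_measure mu T.

(** Separability yields countably many pieces in balls of radius [delta / 4]. A nonempty piece lies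
    in [ball z (delta / 2)] for a point [z] of its own, so domination at [z] gives the finite
    Hausdorff measure that [negligible_density] requires. *)
Lemma negligible_slow_closed alpha c c' delta (F : set X) : (0 < alpha)%R ->
  (0 < c < c')%R -> (0 < delta)%R -> closed F ->
  F `<=` slow_return T alpha c' delta ->
  mu.-negligible (F `&` hausdorff_dominated alpha c delta : set (borel X)).
Proof.
move=> alpha0 /andP[c0 cc'] delta0 cF slowF; set H := hausdorff_dominated _ _ _.
have mF : measurable (F : set (borel X)) by exact: closed_borel.
have [D [cD dD]] := sepX.
have delta4 : (0 < delta / 4)%R by rewrite divr_gt0.
apply: (@negligibleS _ _ _ mu
    (\bigcup_(q in D) (F `&` H `&` ball q (delta / 4)))).
  move=> x FHx; have [q [xq Dq]] : ball x (delta / 4) `&` D !=set0.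
    apply: dD; last exact: metric_ball_open.
    by exists x; exact: ballxx.
  by exists q => //; split => //; exact: ball_sym.
apply: negligible_countable_bigcup => // q _.
have [A0|/set0P[z [[Fz Hz] zq]]] := eqVneq (F `&` H `&` ball q (delta / 4)) set0.
  by rewrite A0; exact: negligible_set0.
apply: (@negligible_density _ _ mu F alpha delta c c') => //.
- by move=> U mU dU; exact: (slow_return_diam mT invT alpha0 mF mU slowF dU).
- by move=> x [[]].
- rewrite (@le_lt_trans _ _ (hausdorff alpha (ball z (delta / 2))))//.
    apply: le_hausdorff => y [_ qy].
    rewrite (_ : delta / 2 = delta / 4 + delta / 4)%R; last by lra.
    exact: ball_triangle (ball_sym zq) qy.
  rewrite (@le_lt_trans _ _ (c%:E * mu (ball z (delta / 2))))//.
    by apply: Hz; lra.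
  by rewrite -(fineK (fin_num_measure mu _ (ball_borel z _))) -EFinM ltry.
- by move=> x r [[_ Hx] _]; exact: Hx.
Qed.

(** What a closed [F] misses of [S] lies in [V \ F], of measure below [e]; the part in [F] is null
    by [negligible_slow_closed]. *)
Lemma negligible_slow_dominated alpha c c' delta : (0 < alpha)%R ->
  (0 < c < c')%R -> (0 < delta)%R ->
  mu.-negligible (slow_return T alpha c' delta `&`
    hausdorff_dominated alpha c delta : set (borel X)).
Proof.
move=> alpha0 cc' delta0; set S := slow_return _ _ _ _.
apply: negligible_outer => e e0.
have mS : measurable (S : set (borel X)) by exact: slow_return_borel.
have [F [V [cF oV FS SV VF]]] := borel_regular mu mS e0.
have [M [mM M0 FM]] := negligible_slow_closed alpha0 cc' delta0 cF FS.
have mF : measurable (F : set (borel X)) by exact: closed_borel.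
have mV : measurable (V : set (borel X)) by exact: open_borel.
have mVF : measurable (V `\` F : set (borel X)) by exact: measurableD.
exists ((V `\` F) `|` M); split; first exact: measurableU.
  move=> x [Sx Hx]; have [Fx|nFx] := pselect (F x); last by left; split => //; exact: SV.
  by right; apply: FM.
have {}M0 : mu M = 0 by exact: M0.
by rewrite (le_trans (measureU2 mu mVF mM))// [X in _ + X]M0 adde0 ltW.
Qed.

End local_recurrence.

(** * The almost everywhere bound through rational thresholds *)

Theorem theorem3 (R : realType) (X : pmetricType R) (T : X -> X)
    (mu : probability (borel X) R)
    (sepX : separable X)
    (mT : measurable_fun [set: borel X] (T : borel X -> borel X))
    (invT : invariant_measure mu T)
    (ergT : ergodic mu T) :
  forall alpha : R, (0 < alpha)%R ->
    {ae mu, forall x : X,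
      limn_einf (fun n => (n%:R * (mdist (iter n T x) x) `^ alpha)%:E)
        <= upper_density_ratio mu alpha x}.
Proof.
move=> alpha alpha0.
(* A failure of the inequality leaves room for rationals [p < q] between the two sides, and a scale
   [1/(n+1)] suffices: the exceptional set is covered by a countable union. *)
pose bad (i : rat * rat * nat) : set (borel X) :=
  slow_return T alpha (ratr i.1.2) i.2.+1%:R^-1 `&`
  hausdorff_dominated mu alpha (ratr i.1.1) i.2.+1%:R^-1.
pose D := [set i : rat * rat * nat | ((0 : R) < ratr i.1.1 < (ratr i.1.2 : R))%R].
suff : mu.-negligible (\bigcup_(i in D) bad i).
  apply: negligibleS => x /= /negP; rewrite -ltNge => gf.
  set g := upper_density_ratio mu alpha x in gf.
  set f := limn_einf _ in gf.
  have g0 : 0 <= g by exact: upper_density_ratio_ge0.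
  (* A failure forces [g] to be finite; when [f] is [+oo], [b = a + 1] will do. *)
  have [a [b [ga ab bf]]] : exists a b, [/\ g = a%:E, (a < b)%R & b%:E <= f].
    move: g0 gf; case: g => [a _| _|]; [|by rewrite ltNge leey|by rewrite leeNy_eq].
    case: f => [b| |]; [|by exists a, (a + 1)%R; rewrite ltrDl leey|by rewrite ltNge leNye].
    by rewrite lte_fin => ab; exists a, b.
  have a0 : (0 <= a)%R by rewrite -lee_fin -ga.
  have [p] := rat_in_itvoo ab; rewrite in_itv/= => /andP[ap pb].
  have [q] := rat_in_itvoo pb; rewrite in_itv/= => /andP[pq qb].
  have p0 : (0 < ratr p :> R)%R by exact: le_lt_trans ap.
  have [||d1 d10 slow] := @liminf_slow_return _ _ T alpha (ratr q) x alpha0.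
  - exact: lt_trans pq.
  - by rewrite (lt_le_trans _ bf)// lte_fin.
  have [|d2 d20 dom] := @upper_density_dominated _ _ mu alpha (ratr p) x.
    by rewrite -/g ga lte_fin.
  (* Both conditions persist at smaller scales, so one scale serves for both. *)
  have dmin : (0 < Num.min d1 d2)%R by rewrite lt_min d10.
  have [n _ /(_ n (leqnn n))/= nd] := near_infty_natSinv_lt (PosNum dmin).
  move: nd; rewrite lt_min => /andP[/ltW nd1 /ltW nd2].
  exists (p, q, n); first by rewrite /D/= p0.
  by split; [exact: slow_returnS slow|exact: hausdorff_dominatedS dom].
apply: negligible_countable_bigcup => // -[[p q] n] /= pq.
by apply: negligible_slow_dominated => //=; rewrite invr_gt0.
Qed.
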